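(* Let $m\ge 2$ be an integer. (1) The word growth function $\delta_{S_{J_m}}$ satisfies $$\delta_{S_{J_m}}(n+1)-\delta_{S_{J_m}}(n)=\delta_{S_{J_m}}\!\left(\left[\tfrac{n}{m}\right]\right),\qquad n\ge 0.$$ (2) The functions $\gamma_{J_m}$ and $\delta_{S_{J_m}}$ satisfy $$\gamma_{J_m}(n)=\frac1m\left(\delta_{S_{J_m}}(m(n+1))-1\right),\qquad n\ge 0.$$ (3) Set $\gamma_{J_m}^{(2)}(1)=\gamma_{J_m}^{(2)}(2)=1$. For every $n\ge 1$ the value $\gamma_{J_m}^{(2)}(n)$ of the second finite difference is equal to the number of partitions of $n$ into ''sequential'' powers of $m$, i.e. to the cardinality of the set $$\left\{(p_0,p_1,\ldots,p_k)\ :\ k\ge 0,\ \sum_{i=0}^k p_i m^i=n,\ p_i\ge 1,\ i=0,1,\ldots,k\right\}.$$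
   Context: Let $X_m=\{x_0,\ldots,x_{m-1}\}$ and let $X_m^\omega$ be the set of right-infinite words over $X_m$. $J_m$ is the Mealy automaton over $X_m$ with three states $e,f_0,f_1$, which define the following transformations of $X_m^\omega$ (for all $w\in X_m^\omega$): $e$ is the identity; $f_0(x_i w)=x_0 w$ for $0\le i\le m-2$ and $f_0(x_{m-1}w)=x_0 f_0(w)$; $f_1(x_i w)=x_{i+1}w$ for $0\le i\le m-2$ and $f_1(x_{m-1}w)=x_0 f_1(w)$. $S_{J_m}$ is the semigroup of transformations of $X_m^\omega$ generated by $e,f_0,f_1$ under composition; it is a monoid with identity $e$. Length is taken relative to the generators $\{e,f_0,f_1\}$: $\ell(e)=0$, and for $s\ne e$, $\ell(s)$ is the least $l$ such that $s$ is a product of $l$ generators. $\delta_{S_{J_m}}(n)=|\{s\in S_{J_m}:\ell(s)=n\}|$. The growth function $\gamma_{J_m}(n)$ of the automaton is the number of states of the minimal Mealy automaton equivalent to the $n$-th power $J_m^n$ (the $n$-fold product automaton, whose states are $n$-tuples of states of $J_m$, acting by composition), i.e. the number of distinct transformations of the form $g_1g_2\cdots g_n$ with $g_j\in\{e,f_0,f_1\}$; $\gamma_{J_m}(0)=1$. Finite differences of a function $\gamma$: $\gamma^{(1)}(n)=\gamma(n)-\gamma(n-1)$ and $\gamma^{(i)}(n)=\gamma^{(i-1)}(n)-\gamma^{(i-1)}(n-1)$ for $i\ge 2$, $n\ge i+1$. $[r]$ denotes the integral part of $r$. *)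

(* Defs.v *)
From HB Require Import structures.
From mathcomp Require Import all_boot all_order all_algebra.
From mathcomp Require Import finmap all_classical.

Set Implicit Arguments.
Unset Strict Implicit.
Unset Printing Implicit Defensive.

Local Open Scope classical_set_scope.
Local Open Scope nat_scope.

Definition word (X : Type) := nat -> X.

Definition wcons (X : Type) (x : X) (w : word X) : word X :=
  fun k => if k is k'.+1 then w k' else x.

Record mealy (X : finType) := Mealy {
  state :> finType;
  trans : state -> X -> state;
  out : state -> X -> X }.

Section Mealy.
Variable X : finType.
Implicit Type A : mealy X.

Fixpoint run A (q : A) (w : word X) (k : nat) : A :=
  if k is k'.+1 then trans (run q w k') (w k') else q.

Definition act A (q : A) (w : word X) : word X := fun k => out (run q w k) (w k).

Lemma act_wcons A (q : A) x w :
  act q (wcons x w) = wcons (out q x) (act (trans q x) w).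
Proof.
apply/funext => -[|k] //; rewrite /act /=; congr out.
by elim: k => //= k ->.
Qed.

Definition act_seq A (s : seq A) : word X -> word X :=
  foldr (fun q f => act q \o f) id s.

(* A letter passes through the components of a tuple from the last to the
   first, so that (g_1, ..., g_n) acts as g_1 \o ... \o g_n, see act_power. *)
Definition power A (n : nat) : mealy X :=
  @Mealy X {: n.-tuple A}
    (fun t x => [tuple trans (tnth t i) (foldr (@out X A) x (drop i.+1 t)) | i < n])
    (fun t x => foldr (@out X A) x t).

Lemma act_power A n (t : power A n) : act t = act_seq (tval t).
Proof.
elim: n t => [|n IHn] t; apply/funext => w.
  by rewrite (tuple0 (t : 0.-tuple A)) /=; apply/funext => k; rewrite /act /= tuple0.
case/tupleP: (t : n.+1.-tuple A) => q {}t; set u := [tuple of q :: t].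
have transE p (v : n.-tuple A) x :
    trans ([tuple of p :: v] : power A n.+1) x =
    [tuple of trans p (foldr (@out X A) x v) :: trans (v : power A n) x].
  apply: eq_from_tnth => i; rewrite tnth_mktuple.
  case: (unliftP ord0 i) => [j ->|->]; last by rewrite /tnth /= drop0.
  by rewrite !tnthS tnth_mktuple.
have runE k : run (u : power A n.+1) w k =
    [tuple of run q (act (t : power A n) w) k :: run (t : power A n) w k].
  by elim: k => [|k IHk] //; rewrite [LHS]/= IHk; exact: transE.
rewrite /= -IHn; apply/funext => k.
by rewrite {1}/act runE.
Qed.

(* Equivalent automata define the same set of transformations. *)
Definition equivalent A B : Prop := range (@act A) = range (@act B).

Lemma ex_equivalent_size A :
  exists k, `[< exists2 B : mealy X, equivalent A B & #|B| = k >].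
Proof. by exists #|A|; apply/asboolP; exists A. Qed.

Definition minimal_size A : nat := ex_minn (ex_equivalent_size A).

Definition growth A (n : nat) : nat := minimal_size (power A n).

Definition semigroup A : set (word X -> word X) :=
  smallest (fun S : set (word X -> word X) => forall s t, S s -> S t -> S (s \o t))
    (range (@act A)).

Definition products A (l : nat) : set (word X -> word X) :=
  range (fun t : l.-tuple A => act_seq t).

Definition has_length A (s : word X -> word X) (l : nat) : Prop :=
  (s = id /\ l = 0) \/
  [/\ s <> id, products A l s & forall k, products A k s -> l <= k].

Definition sphere A (n : nat) : set (word X -> word X) :=
  [set s | semigroup A s /\ has_length A s n].

Lemma finite_sphere A n : finite_set (sphere A n).
Proof.
apply: (@sub_finite_set _ _ ([set id] `|` products A n)).
  by move=> s [_ [[-> _]|[_ sn _]]]; [left|right].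
rewrite finite_setU; split; first exact: finite_set1.
exact/finite_image/finite_finset.
Qed.

Definition word_growth A (n : nat) : nat := #|` fset_set (sphere A n)|.

End Mealy.

Inductive J_state := Je | Jf0 | Jf1.

Definition J_state_code (q : J_state) : option bool :=
  match q with Je => None | Jf0 => Some false | Jf1 => Some true end.

Definition J_state_decode (c : option bool) : J_state :=
  match c with None => Je | Some false => Jf0 | Some true => Jf1 end.

Lemma J_state_codeK : cancel J_state_code J_state_decode.
Proof. by case. Qed.

HB.instance Definition _ := Finite.copy J_state (can_type J_state_codeK).

Definition ord_zero (m : nat) (i : 'I_m) : 'I_m :=
  Ordinal (leq_ltn_trans (leq0n i) (ltn_ord i)).

(* ordS sends i to i + 1 for i < m - 1, and m - 1 to 0. *)
Definition J (m : nat) : mealy 'I_m :=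
  @Mealy 'I_m J_state
    (fun q i => if i.+1 == m then q else Je)
    (fun q i => match q with
                | Je => i
                | Jf0 => ord_zero i
                | Jf1 => ordS i
                end).

Lemma act_Je m w : act (Je : J m) w = w.
Proof.
apply/funext => k; rewrite /act; suff -> : run (Je : J m) w k = Je by [].
by elim: k => //= k ->; case: ifP.
Qed.

Lemma act_Jf0 m i w : act (Jf0 : J m) (wcons i w) =
  wcons (ord_zero i) (if i.+1 == m then act (Jf0 : J m) w else w).
Proof. by rewrite act_wcons /=; case: ifP => // _; rewrite act_Je. Qed.

Lemma act_Jf1 m i w : act (Jf1 : J m) (wcons i w) =
  if i.+1 == m then wcons (ord_zero i) (act (Jf1 : J m) w) else wcons (ordS i) w.
Proof.
rewrite act_wcons /=; case: ifP => [/eqP im|_]; last by rewrite act_Je.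
by congr wcons; apply: val_inj; rewrite /= im modnn.
Qed.

Definition fdiff (f : nat -> int) (n : nat) : int := (f n - f n.-1)%R.

(* The values at 1 and 2 are set by convention; for n >= 3 the iterated
   difference is g n - 2 g (n - 1) + g (n - 2) with no truncation. *)
Definition growth_diff2 (m n : nat) : int :=
  if (n == 1) || (n == 2) then 1%R
  else iter 2 fdiff (fun k => Posz (growth (J m) k)) n.

(* The sequence p stands for (p_0, ..., p_k) with k = (size p).-1. *)
Definition seq_power_partitions (m n : nat) : set (seq nat) :=
  [set p | [/\ 0 < size p, \sum_(i < size p) nth 0 p i * m ^ i = n
             & forall i, i < size p -> 1 <= nth 0 p i]].

Lemma finite_seq_power_partitions m n :
  1 < m -> finite_set (seq_power_partitions m n).
Proof.
move=> m1.
pose F (pt : {s : 'I_n.+1 & s.-tuple 'I_n.+1}) : seq nat :=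
  map val (tval (tagged pt)).
apply: (@sub_finite_set _ _ (range F)); last exact/finite_image/finite_finset.
move=> p [p0 pn p1].
have leF i : i < size p -> nth 0 p i * m ^ i <= n.
  by move=> ip; rewrite -pn (bigD1 (Ordinal ip)) //= leq_addr.
have sizep : size p < n.+1.
  rewrite ltnS -(prednK p0); have ip : (size p).-1 < size p by rewrite prednK.
  apply: leq_trans (ltn_expl _ m1) (leq_trans _ (leF _ ip)).
  by rewrite leq_pmull // p1.
have entp i : i < size p -> nth 0 p i < n.+1.
  move=> ip; rewrite ltnS; apply: leq_trans (leF _ ip).
  by rewrite leq_pmulr // expn_gt0 (ltnW m1).
pose u : (size p).-tuple 'I_n.+1 := [tuple inord (nth 0 p i) | i < size p].
exists (@Tagged _ (Ordinal sizep) (fun s : 'I_n.+1 => s.-tuple 'I_n.+1) u) => //.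
have su : size (map val u) = size p by rewrite size_map size_tuple.
apply: (@eq_from_nth _ 0) => // i; rewrite su => ip.
rewrite (nth_map ord0) ?size_tuple // -(tnth_nth _ u (Ordinal ip)) tnth_mktuple.
by rewrite /= inordK // entp.
Qed.

(* Main.v *)
Require Import Defs.
From mathcomp Require Import all_boot all_order all_algebra.
From mathcomp Require Import finmap all_classical.
From mathcomp Require Import zify ring.

(** Read an infinite word as an m-adic integer, least significant digit first.
    Then f1 is x |-> x + 1, and f0 adds 1 and erases the lowest nonzero digit
    of the sum (it sends -1 to 0).  Everything rests on a normal form for
    products of f0 and f1.

    After one application of f0 the word is 0 w.  On such words f1^(q m + r),
    r < m, acts as 0 w |-> r (f1^q w); a further f0 then either just erases r,
    when r < m - 1, or carries, giving 0 (f0 (f1^q w)), when r = m - 1.  So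
    f0 f1^(q m + r) f0 shortens to f1^(q m) f0 unless r = m - 1, and in that
    case the same analysis repeats on the tail w.  Hence every product equals
    some
      f1^a  f0 f1^(p_k m^k - 1)  ...  f0 f1^(p_1 m - 1)  f0 f1^(p_0 - 1)
    with all p_i >= 1, whose length a + p_0 + p_1 m + ... + p_k m^k, called the
    weight of the pair (a, p), does not exceed that of the product
    (act_seq_reduce).

    Distinct normal forms act differently (nf_act_inj).  If p_0 < q_0, consider
    the words with low part m^N - p_0 and arbitrary high part u, N large.  The
    element with first part p_0 brings the low N digits to m^N - 1 just before
    its first f0, which then carries through to u and acts on it
    non-injectively; the element with first part q_0 brings them to 0 without
    having used f0, and the few remaining generators never reach the N-th
    digit again, so it keeps u apart (act_seq_F1_separates).  Thus p_0 = q_0,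
    and comparing tails gives an induction.

    Therefore delta(n) counts the pairs (a, p) of weight n.  Such a pair of
    weight n + 1 either has a > 0, and decreasing a gives weight n; or it has
    a = 0, and then p is a sequential partition of n + 1, which is determined
    by its p_1, p_2, ..., a sequence of weight at most [n/m], or equivalently
    by a pair of weight [n/m] (card_normal_formsS).  This is (1), and it also
    identifies the number of sequential partitions of n + 1 with delta([n/m]),
    which is (3), since gamma(n) = delta(0) + ... + delta(n).  Summing (1) over
    blocks of m consecutive integers gives (2). *)

Set Implicit Arguments.
Unset Strict Implicit.
Unset Printing Implicit Defensive.

Local Open Scope classical_set_scope.
Local Open Scope nat_scope.

(** * Cardinals of finite sets *)

Section Cardinal.
Variables T U : choiceType.

Lemma card_fset_set_image (f : T -> U) (A : set T) :
  finite_set A -> {in A &, injective f} ->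
  #|` fset_set (f @` A)| = #|` fset_set A|.
Proof.
move=> finA injf; rewrite fset_set_image // card_in_imfset //= => x y.
by rewrite !in_fset_set //; exact: injf.
Qed.

Lemma card_fset_set_disjU (A B : set T) :
  finite_set A -> finite_set B -> A `&` B = set0 ->
  #|` fset_set (A `|` B)| = #|` fset_set A| + #|` fset_set B|.
Proof.
move=> finA finB AB0; rewrite fset_setU // -cardfsUI -fset_setI // AB0 fset_set0.
by rewrite cardfs0 addn0.
Qed.

Lemma card_fset_set_range (F : finType) (f : F -> U) :
  #|` fset_set (range f)| <= #|F|.
Proof.
suff -> : fset_set (range f) = [fset f x | x in F]%fset.
  by rewrite cardE (leq_trans (leq_imfset_card _ _ _)) // enum_finmemE.
apply/fsetP => y; rewrite in_fset_set; last exact/finite_image/finite_finset.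
apply/idP/imfsetP => [|[x _ ->]]; rewrite inE /=; last by exists x.
by case=> x _ <-; exists x.
Qed.

End Cardinal.

(** * Minimal automata and products of states *)

Section Automata.
Variable X : finType.
Implicit Types A B : mealy X.

Lemma wcons_eta (w : word X) : w = wcons (w 0) (fun k => w k.+1).
Proof. by apply/funext => -[]. Qed.

Lemma wcons_inj (x y : X) (w v : word X) : wcons x w = wcons y v -> x = y /\ w = v.
Proof.
move=> eq_wv; split; first exact: (congr1 (fun z => z 0) eq_wv).
by apply/funext => k; exact: (congr1 (fun z => z k.+1) eq_wv).
Qed.

Lemma act_out A (q : A) x : out q x = act q (fun=> x) 0.
Proof. by []. Qed.

Lemma eq_act_trans A B (q : A) (r : B) x :
  act q = act r -> act (trans q x) = act (trans r x).
Proof.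
move=> eq_qr; apply/funext => w.
by have := congr1 (@^~ (wcons x w)) eq_qr; rewrite /= !act_wcons => /wcons_inj[].
Qed.

Lemma finite_range_act A : finite_set (range (@act X A)).
Proof. exact/finite_image/finite_finset. Qed.

(** The transformations themselves serve as the states: by [act_out] and
    [eq_act_trans], output and next transformation depend on a state only
    through its action, so any representative may be used to define them. *)
Lemma exists_reduced A : exists2 B : mealy X,
  equivalent A B & #|B| = #|` fset_set (range (@act X A))|.
Proof.
set S := fset_set (range (@act X A)).
have actS (q : A) : act q \in S.
  by rewrite in_fset_set ?inE /=; [exists q | exact: finite_range_act].
have repr (s : S) : {q : A | act q = fsval s}.
  apply: cid; have := fsvalP s.
  rewrite in_fset_set ?inE; last exact: finite_range_act.
  by case=> q _ <-; exists q.
pose rep s := projT1 (repr s).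
have repE s : act (rep s) = fsval s := projT2 (repr s).
pose B := @Mealy X S (fun s x => [` actS (trans (rep s) x)]%fset)
                     (fun s x => out (rep s) x).
have actB (s : B) : act s = fsval s.
  rewrite -repE; apply/funext => w; apply/funext => k.
  have runE : fsval (run s w k) = act (run (rep s) w k).
    elim: k => [|k IHk] /=; first by rewrite repE.
    rewrite (eq_act_trans (B := A) (r := run (rep s) w k)) // repE; exact: IHk.
  change (out (rep (run s w k)) (w k) = out (run (rep s) w k) (w k)).
  by rewrite !act_out repE runE.
exists B; last by rewrite -cardfE.
apply/seteqP; split=> _ [q _ <-]; last by exists (rep q); rewrite ?actB ?repE.
by exists [` actS q]%fset; rewrite ?actB.
Qed.

Lemma minimal_sizeE A : minimal_size A = #|` fset_set (range (@act X A))|.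
Proof.
rewrite /minimal_size; case: ex_minnP => k /asboolP[B eqAB <-] minB.
apply/eqP; rewrite eqn_leq minB; last by apply/asboolP; exact: exists_reduced.
by rewrite eqAB card_fset_set_range.
Qed.

Lemma growthE A n : growth A n = #|` fset_set (products A n)|.
Proof.
rewrite /growth minimal_sizeE; congr (#|` fset_set _|).
by apply/seteqP; split=> _ [t _ <-]; exists t; rewrite // act_power.
Qed.

Lemma act_seq_cat A (s t : seq A) : act_seq (s ++ t) = act_seq s \o act_seq t.
Proof. by elim: s => //= q s ->. Qed.

Lemma act_seq_nseq A l (q : A) : act_seq (nseq l q) = iter l (act q).
Proof. by apply/funext => w; elim: l => //= l <-. Qed.

End Automata.

(** * The two generators acting on m-adic words *)

Section Actions.
Variable n : nat.
Local Notation m := n.+2.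
Local Notation X := 'I_m.
Local Notation f0 := (Jf0 : J m).
Local Notation f1 := (Jf1 : J m).
Local Notation F0 := (act f0).
Local Notation F1 := (act f1).

Lemma ltn_modm v : v %% m < m. Proof. exact: ltn_pmod. Qed.
Definition digit v : X := Ordinal (ltn_modm v).

Lemma digit_inj v w : digit v = digit w -> v %% m = w %% m.
Proof. by move/(congr1 val). Qed.

Lemma F0_wcons i w :
  F0 (wcons i w) = wcons ord0 (if i.+1 == m then F0 w else w).
Proof. by rewrite act_Jf0; congr wcons; apply: val_inj. Qed.

Lemma F1_wcons i w :
  F1 (wcons i w) = wcons (digit i.+1) (if i.+1 == m then F1 w else w).
Proof.
rewrite act_Jf1; case: ifP => [/eqP im|_]; congr wcons; apply: val_inj => //=.
by rewrite im modnn.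
Qed.

Lemma F1_inj : injective F1.
Proof.
have ordSE (i : X) : digit i.+1 = ordS i by exact: val_inj.
move=> w v eqF; apply/funext => k; elim: k w v eqF => [|k IHk] w v;
  rewrite (wcons_eta w) (wcons_eta v) !F1_wcons !ordSE;
  move=> /wcons_inj[/ordS_inj eq_hd eq_tl].
  exact: eq_hd.
move: eq_tl; rewrite /= eq_hd; case: ifP => _ eq_tl; first exact: IHk eq_tl.
exact: (congr1 (@^~ k) eq_tl).
Qed.

(** A preimage is subtraction of 1: every digit is decremented as long as all
    the earlier ones are 0, which is exactly when the carry is alive. *)
Lemma F1_surj v : exists w, F1 w = v.
Proof.
pose w k := if all (fun j => v j == ord0) (iota 0 k) then ord_pred (v k) else v k.
have succ0 (i : X) : ((ord_pred i).+1 == m) = (i == ord0).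
  rewrite -val_eqE /=; have := ltn_ord i; case: (i : nat) => [|j] jm /=.
    by rewrite modn_small // eqxx.
  by rewrite modnDr modn_small; lia.
exists w.
have runE k : run f1 w k =
    if all (fun j => v j == ord0) (iota 0 k) then f1 else Je.
  elim: k => [|k IHk] //; rewrite [LHS]/= IHk /w -(addn1 k) iotaD all_cat /= andbT.
  by case: (all _ _) => /=; [rewrite succ0; case: ifP | case: ifP].
apply/funext => k; rewrite /act runE /w; case: (all _ _) => //=.
exact: ord_predK.
Qed.

Lemma iterF1_inj c : injective (iter c F1).
Proof. by elim: c => //= c IHc w v /F1_inj/IHc. Qed.

Lemma iterF1_surj c v : exists w, iter c F1 w = v.
Proof.
elim: c v => [|c IHc] v; first by exists v.
by case: (F1_surj v) => u <-; case: (IHc u) => w <-; exists w.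
Qed.

(** Adding m to a number carries exactly once out of its first digit. *)
Lemma iterF1_digit q r w : r < m ->
  iter (q * m + r) F1 (wcons ord0 w) = wcons (digit r) (iter q F1 w).
Proof.
move=> rm; have step c i u : i + c < m ->
    iter c F1 (wcons (digit i) u) = wcons (digit (i + c)) u.
  elim: c => [|c IHc] icm; first by rewrite addn0.
  rewrite iterS IHc; last lia.
  rewrite F1_wcons ifN /= ?modn_small; try lia.
  by congr wcons; apply: val_inj; rewrite /= addnS.
have {}step u c : c < m -> iter c F1 (wcons ord0 u) = wcons (digit c) u.
  move=> cm; rewrite -[in RHS](add0n c) -step //.
  by congr (iter _ _ (wcons _ _)); apply: val_inj.
have full u : iter m F1 (wcons ord0 u) = wcons ord0 (F1 u).
  rewrite iterS step // F1_wcons /= modn_small // eqxx.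
  by congr wcons; apply: val_inj; rewrite /= modnn.
elim: q => [|q IHq] in w *; first by rewrite add0n step.
by rewrite mulSn -addnA addnC iterD full IHq -iterSr.
Qed.

Lemma F0_carry w : F0 (wcons (digit n.+1) w) = wcons ord0 (F0 w).
Proof. by rewrite F0_wcons /= modn_small // eqxx. Qed.

Lemma F0_nocarry r w : r < n.+1 -> F0 (wcons (digit r) w) = wcons ord0 w.
Proof. by move=> rn; rewrite F0_wcons /= ifN // modn_small; lia. Qed.

Lemma F0_zero w : exists v, F0 w = wcons ord0 v.
Proof. by rewrite (wcons_eta w) F0_wcons; eexists. Qed.

Lemma F0_surj_zero c w : exists v, F0 (iter c F1 v) = wcons ord0 w.
Proof.
case: (iterF1_surj c (wcons (digit 0) w)) => v vE; exists v.
by rewrite vE F0_nocarry.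
Qed.

(** The m-adic integer with low digits those of v (taken modulo m ^ N) and high
    part u, that is, v + m ^ N u when v < m ^ N. *)
Fixpoint adic (N v : nat) (u : word X) : word X :=
  if N is N'.+1 then wcons (digit v) (adic N' (v %/ m) u) else u.

Lemma adic_inj N v : injective (adic N v).
Proof. by elim: N v => [|N IHN] v w u //= /wcons_inj[_ /IHN]. Qed.

Lemma adic_inj_val N v w u : v < m ^ N -> w < m ^ N ->
  adic N v u = adic N w u -> v = w.
Proof.
elim: N v w => [|N IHN] v w; first by rewrite !ltnS !leqn0 => /eqP-> /eqP->.
rewrite !expnSr => vN wN /= /wcons_inj[/digit_inj eq_mod /IHN eq_div].
by rewrite (divn_eq v m) eq_mod eq_div ?ltn_divLR // -divn_eq.
Qed.

Lemma F1_adic N v u : v.+1 < m ^ N -> F1 (adic N v u) = adic N v.+1 u.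
Proof.
elim: N v => [|N IHN] v; first by rewrite ltnS ltn0.
rewrite expnSr => vN /=; rewrite F1_wcons /=; case: ifP => [/eqP|/eqP] carry.
  have vE : v.+1 = (v %/ m).+1 * m.
    by rewrite {1}(divn_eq v m) -addnS carry mulSn addnC.
  rewrite IHN; last by rewrite -(ltn_pmul2r (m := m)) // -vE.
  congr wcons; last by rewrite vE mulnK.
  by apply: val_inj; rewrite /= carry vE modnn modnMl.
have lt_vm : (v %% m).+1 < m by have := ltn_modm v; lia.
have vE : v.+1 = (v %/ m) * m + (v %% m).+1 by rewrite addnS -divn_eq.
congr wcons; last by rewrite vE divnMDl // (divn_small lt_vm) addn0.
by apply: val_inj; rewrite /= vE modnMDl.
Qed.

Lemma iterF1_adic c N v u : v + c < m ^ N ->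
  iter c F1 (adic N v u) = adic N (v + c) u.
Proof.
elim: c => [|c IHc] vN; first by rewrite addn0.
by rewrite iterS IHc ?F1_adic ?addnS //; lia.
Qed.

Lemma F0_adic N v : v.+1 < m ^ N ->
  exists2 v', v' <= v & forall u, F0 (adic N v u) = adic N v' u.
Proof.
elim: N v => [|N IHN] v; first by rewrite ltnS ltn0.
rewrite expnSr => vN; have [carry|nocarry] := eqVneq (v %% m).+1 m.
  have vE : v.+1 = (v %/ m).+1 * m.
    by rewrite {1}(divn_eq v m) -addnS carry mulSn addnC.
  case: (IHN (v %/ m)) => [|v' le_v' v'E].
    by rewrite -(ltn_pmul2r (m := m)) // -vE.
  exists (v' * m) => [|u]; first by rewrite -leq_divRL.
  rewrite /= F0_wcons /= carry eqxx v'E mulnK //.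
  by congr wcons; apply: val_inj; rewrite /= modnMl.
exists (v %/ m * m) => [|u]; first exact: leq_divM.
rewrite /= F0_wcons /= ifN // mulnK //.
by congr wcons; apply: val_inj; rewrite /= modnMl.
Qed.

(** Neither generator increases a number by more than 1, so a short product
    never carries out of the low N digits, and it acts on them independently of
    the high part. *)
Lemma act_seq_adic (t : seq (J m)) N v : v + size t < m ^ N ->
  exists2 v', v' <= v + size t & forall u, act_seq t (adic N v u) = adic N v' u.
Proof.
elim: t => [|q t IHt] vN; first by exists v; rewrite ?addn0.
move: vN => /=; rewrite addnS => vN.
case: IHt => [|v' le_v' v'E]; first exact: ltnW.
have v'N : v'.+1 < m ^ N by apply: leq_ltn_trans vN.
case: q => /=.
- by exists v' => [|u]; [exact: leqW | rewrite v'E act_Je].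
- case: (@F0_adic N v') => [//|w le_w wE].
  by exists w => [|u]; [exact/(leq_trans le_w)/leqW | rewrite v'E wE].
- by exists v'.+1 => [|u]; [ | rewrite v'E F1_adic].
Qed.

Lemma predn_expS N : (m ^ N.+1).-1 = (m ^ N).-1 * m + n.+1.
Proof.
have := expn_gt0 m N; rewrite expnSr.
by case: (m ^ N) => // k _; rewrite mulSn; lia.
Qed.

(** On low digits all equal to m - 1 the carry does reach the high part. *)
Lemma F0_adic_max N u : F0 (adic N (m ^ N).-1 u) = adic N 0 (F0 u).
Proof.
elim: N => // N IHN; rewrite predn_expS /= F0_wcons /= modnMDl modn_small // eqxx.
by rewrite divnMDl // divn_small // addn0 IHN div0n; congr wcons; apply: val_inj.
Qed.

Lemma F1_adic_max N u : F1 (adic N (m ^ N).-1 u) = adic N 0 (F1 u).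
Proof.
elim: N => // N IHN; rewrite predn_expS /= F1_wcons /= modnMDl modn_small // eqxx.
rewrite divnMDl // divn_small // addn0 IHN div0n; congr wcons; apply: val_inj.
by rewrite /= modnn mod0n.
Qed.

(** f0 is idempotent, and not the identity. *)
Lemma F0_noninj : exists u v, u <> v /\ F0 u = F0 v.
Proof.
pose u : word X := fun=> digit 1; exists u, (F0 u); split.
  by case: (F0_zero u) => v -> /(congr1 (fun z => val (z 0))).
have F0K w : F0 (wcons ord0 w) = wcons ord0 w by rewrite F0_wcons.
by case: (F0_zero u) => v ->; rewrite F0K.
Qed.

(** The words x u represent (m ^ N - 1 - c) + m ^ N u.  After c steps of f1 their
    low part is maximal: on the left one more f1 turns u into F1 u, which the
    low-part action of t then leaves alone; on the right f0 turns u into F0 u.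
    As F1 is injective and F0 is not, the two sides differ. *)
Lemma act_seq_F1_separates (t d : seq (J m)) c :
  act_seq t \o iter c.+1 F1 <> act_seq d \o (F0 \o iter c F1).
Proof.
move=> eq_td; case: F0_noninj => u [v [neq_uv eq_F]].
(* N is chosen so that t cannot carry out of the low part, and so that
   m ^ N - 1 - c is not truncated. *)
pose N := (size t + c).+1.
have ltN : size t + c < m ^ N by apply: ltn_trans (ltn_expl N _).
pose x := adic N ((m ^ N).-1 - c).
have xmax w : iter c F1 (x w) = adic N (m ^ N).-1 w.
  have cN : c <= (m ^ N).-1 by case: (m ^ N) ltN => // M; rewrite ltnS; lia.
  by rewrite iterF1_adic subnK // ltn_predL (leq_ltn_trans _ ltN).
case: (@act_seq_adic t N 0) => [|v' _ v'E]; first exact/leq_ltn_trans/ltN/leq_addr.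
have := congr1 (@^~ (x u)) eq_td; have := congr1 (@^~ (x v)) eq_td.
rewrite /= !xmax !F0_adic_max !F1_adic_max eq_F !v'E => <- /adic_inj/F1_inj.
exact: neq_uv.
Qed.

End Actions.

(** * Normal forms *)

Fixpoint power_sum (m : nat) (p : seq nat) : nat :=
  if p is c :: p' then c + m * power_sum m p' else 0.

Section NormalForms.
Variable n : nat.
Local Notation m := n.+2.
Local Notation X := 'I_m.
Local Notation f0 := (Jf0 : J m).
Local Notation f1 := (Jf1 : J m).
Local Notation F0 := (act f0).
Local Notation F1 := (act f1).

(** The entry p_i of the sequence, i counted from j, contributes the block
    f0 f1^(p_i m^i - 1), of length p_i m^i; blocks are in decreasing order
    of i because the rightmost letter acts first. *)
Fixpoint tail_word (j : nat) (p : seq nat) : seq (J m) :=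
  if p is c :: p' then tail_word j.+1 p' ++ f0 :: nseq (c * m ^ j).-1 f1
  else [::].

Definition nf_word (x : nat * seq nat) : seq (J m) := nseq x.1 f1 ++ tail_word 0 x.2.

Definition nf_act (x : nat * seq nat) : word X -> word X := act_seq (nf_word x).

Definition nf_weight (x : nat * seq nat) : nat := x.1 + power_sum m x.2.

Lemma size_tail_word j p : all (leq 1) p ->
  size (tail_word j p) = m ^ j * power_sum m p.
Proof.
elim: p j => [|c p IHp] j /=; first by rewrite muln0.
case/andP=> c_gt0 p_gt0; rewrite size_cat IHp //= size_nseq.
by rewrite prednK ?muln_gt0 ?c_gt0 ?expn_gt0 // expnSr; lia.
Qed.

Lemma size_nf_word x : all (leq 1) x.2 -> size (nf_word x) = nf_weight x.
Proof.
by move=> x_gt0; rewrite size_cat size_nseq size_tail_word // expn0 mul1n.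
Qed.

(** Self-similarity: on words starting with 0 a block f0 f1^(c m - 1) always
    carries, and so acts on the tail as f0 f1^(c - 1). *)
Lemma act_tail_wordS j p w : all (leq 1) p ->
  act_seq (tail_word j.+1 p) (wcons ord0 w) = wcons ord0 (act_seq (tail_word j p) w).
Proof.
elim: p j w => //= c p IHp j w /andP[c_gt0 p_gt0].
rewrite !act_seq_cat /= !act_seq_nseq.
have -> : (c * m ^ j.+1).-1 = (c * m ^ j).-1 * m + n.+1.
  have: 0 < c * m ^ j by rewrite muln_gt0 c_gt0 expn_gt0.
  by rewrite expnSr mulnA; case: (c * m ^ j) => // k _; rewrite mulSn; lia.
rewrite iterF1_digit // F0_carry.
by case: (F0_zero (iter (c * m ^ j).-1 F1 w)) => v ->; rewrite IHp.
Qed.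

Lemma nf_act_cons a c p w v : all (leq 1) p ->
  F0 (iter c.-1 F1 w) = wcons ord0 v ->
  nf_act (a, c :: p) w = iter a F1 (wcons ord0 (act_seq (tail_word 0 p) v)).
Proof.
move=> p_gt0 wv; rewrite /nf_act !act_seq_cat /= !act_seq_nseq muln1 wv.
by rewrite act_tail_wordS.
Qed.

Lemma act_nf a p : nf_act (a, p) = iter a F1 \o act_seq (tail_word 0 p).
Proof. by rewrite /nf_act act_seq_cat act_seq_nseq. Qed.

(** With a = q m + r: if r < m - 1 the new f0 only erases the digit r; if
    r = m - 1 it carries, and the tail p' of p is treated recursively with
    f0 f1^q in front. *)
Lemma F0_reduce a p : all (leq 1) p ->
  exists x, [/\ all (leq 1) x.2, nf_weight x <= (nf_weight (a, p)).+1
              & F0 \o nf_act (a, p) = nf_act x].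
Proof.
elim: p a => [|c p IHp] a p_gt0.
  exists (0, [:: a.+1]); split=> //; first by rewrite /nf_weight /=; lia.
  by apply/funext => w; rewrite /= !act_nf /= muln1 act_seq_nseq.
have {}p_gt0 : (0 < c) && all (leq 1) p := p_gt0; have /andP[c_gt0 p'_gt0] := p_gt0.
have aE := divn_eq a m; set q := a %/ m in aE; set r := a %% m in aE.
have rm : r < m by rewrite ltn_mod.
have [rn|rn] := ltnP r n.+1.
  exists (q * m, c :: p); split=> //; first by rewrite /nf_weight /=; lia.
  apply/funext => w /=; case: (F0_zero (iter c.-1 F1 w)) => v wv.
  rewrite !(nf_act_cons _ p'_gt0 wv) aE iterF1_digit // F0_nocarry //.
  by rewrite -[q * m]addn0 iterF1_digit //; congr wcons; apply: val_inj.
have {rn}rE : r = n.+1 by lia.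
case: (IHp q p'_gt0) => -[b s] /= [s_gt0 le_s sE].
exists (b * m, c :: s); split; first by rewrite /= c_gt0.
  by move: le_s; rewrite /nf_weight /=; nia.
apply/funext => w /=; case: (F0_zero (iter c.-1 F1 w)) => v wv.
rewrite (nf_act_cons _ p'_gt0 wv) (nf_act_cons _ s_gt0 wv) aE iterF1_digit //.
rewrite rE F0_carry -[b * m]addn0 iterF1_digit //.
have := congr1 (@^~ v) sE; rewrite !act_nf /= => ->.
by congr wcons; apply: val_inj.
Qed.

Lemma act_seq_reduce (t : seq (J m)) :
  exists x, [/\ all (leq 1) x.2, nf_weight x <= size t & act_seq t = nf_act x].
Proof.
elim: t => [|q t [[a p] [/= p_gt0 le_p pE]]]; first by exists (0, [::]).
case: q; rewrite /= pE.
- exists (a, p); split=> //; first exact: leqW.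
  by apply/funext => w; rewrite /= act_Je.
- case: (F0_reduce a p_gt0) => x [x_gt0 le_x xE]; exists x; split=> //.
  exact: leq_trans le_x _.
- by exists (a.+1, p).
Qed.

(** If c < d, the form with head d ends with f1^c, whereas the other ends with
    f0 f1^(c - 1), so [act_seq_F1_separates] applies. *)
Lemma nf_act_head_leq a b c d p q : all (leq 1) (c :: p) -> all (leq 1) (d :: q) ->
  nf_act (a, c :: p) = nf_act (b, d :: q) -> d <= c.
Proof.
move=> /=/andP[c_gt0 p_gt0] /andP[d_gt0 q_gt0] eq_cd.
rewrite leqNgt; apply/negP => lt_cd.
apply: (@act_seq_F1_separates n
  (nseq b f1 ++ tail_word 1 q ++ f0 :: nseq (d.-1 - c) f1)
  (nseq a f1 ++ tail_word 1 p) c.-1).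
rewrite prednK //; move: eq_cd; rewrite /nf_act /nf_word /= !muln1.
rewrite (_ : nseq d.-1 f1 = nseq (d.-1 - c) f1 ++ nseq c f1); last first.
  by rewrite -nseqD subnK //; lia.
rewrite !act_seq_cat /= !act_seq_cat !act_seq_nseq => eq_cd.
by apply/funext => w; have /= := congr1 (@^~ w) eq_cd.
Qed.

(** Powers of F1 are injective, and a product containing F0 is not, since
    what precedes F0 is surjective. *)
Lemma nf_act_cons_neq_nil a b c p : nf_act (a, c :: p) <> nf_act (b, [::]).
Proof.
move=> eq_ab; case: (F0_noninj n) => u [v [neq_uv eq_F]]; apply: neq_uv.
pose k := (c * m ^ 0).-1.
case: (iterF1_surj k u) eq_F => u' <-; case: (iterF1_surj k v) => v' <- eq_F.
congr (iter k F1 _); apply: (@iterF1_inj n b).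
have bE w : iter b F1 w = nf_act (b, [::]) w by rewrite act_nf.
by rewrite !bE -eq_ab !act_nf /= !act_seq_cat /= act_seq_nseq eq_F.
Qed.

Lemma iterF1_eq a b : iter a F1 = iter b F1 -> a = b.
Proof.
move=> eq_ab; pose N := a + b; have ltN : a + b < m ^ N by exact: ltn_expl.
have := congr1 (@^~ (adic N 0 (fun=> ord0))) eq_ab.
have aN : 0 + a < m ^ N by apply: leq_ltn_trans ltN; rewrite leq_addr.
have bN : 0 + b < m ^ N by apply: leq_ltn_trans ltN; rewrite leq_addl.
by rewrite /= !iterF1_adic //; exact: adic_inj_val.
Qed.

(** Once the heads agree, the input of the tail forms runs over all words
    ([F0_surj_zero]); the first output digit gives a mod m, and the rest of the
    output compares the normal forms of a / m and the tails of p. *)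
Lemma nf_act_inj x y : all (leq 1) x.2 -> all (leq 1) y.2 ->
  nf_act x = nf_act y -> x = y.
Proof.
case: x y => [a p] [b q] /=.
elim: p a b q => [|c p IHp] a b [|d q] p_gt0 q_gt0.
- by rewrite !act_nf => /iterF1_eq->.
- by move=> eq_ab; case: (nf_act_cons_neq_nil (esym eq_ab)).
- by move/nf_act_cons_neq_nil.
move=> eq_ab; have eq_cd : c = d.
  by apply/eqP; rewrite eqn_leq (nf_act_head_leq p_gt0 q_gt0 eq_ab)
     (nf_act_head_leq q_gt0 p_gt0 (esym eq_ab)).
rewrite -{d}eq_cd in q_gt0 eq_ab *.
case/andP: p_gt0 q_gt0 => _ p_gt0 /andP[_ q_gt0].
have step v : digit n (a %% m) = digit n (b %% m) /\
    nf_act (a %/ m, p) v = nf_act (b %/ m, q) v.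
  case: (F0_surj_zero c.-1 v) => w wv; have := congr1 (@^~ w) eq_ab.
  rewrite /= (nf_act_cons _ p_gt0 wv) (nf_act_cons _ q_gt0 wv).
  rewrite {1}(divn_eq a m) {1}(divn_eq b m) !iterF1_digit ?ltn_mod //.
  move=> /wcons_inj[-> eq_v].
  by rewrite !act_nf.
have [eq_div eq_pq] : (a %/ m, p) = (b %/ m, q).
  by apply: IHp => //; apply/funext => v; case: (step v).
have /digit_inj : digit n (a %% m) = digit n (b %% m) by case: (step (fun=> ord0)).
by rewrite !modn_mod => eq_mod; rewrite (divn_eq a m) eq_div eq_mod -divn_eq eq_pq.
Qed.
End NormalForms.

(** * Counting *)

Section Counting.
Variable n : nat.
Local Notation m := n.+2.
Local Notation X := 'I_m.
Local Notation f0 := (Jf0 : J m).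
Local Notation f1 := (Jf1 : J m).

Definition normal_forms (k : nat) : set (nat * seq nat) :=
  [set x | all (leq 1) x.2 /\ nf_weight n x = k].

Definition incr_nf (x : nat * seq nat) := (x.1.+1, x.2).

(** Prepends to p_1, p_2, ... the part p_0 which brings the sum to k + 1; the
    subtraction is not truncated when the pair has weight k / m, and then
    p_0 >= 1. *)
Definition parts_of_nf (k : nat) (x : nat * seq nat) : seq nat :=
  k.+1 - m * power_sum m x.2 :: x.2.

(** A sequential partition of k + 1 is determined by its parts after p_0, whose
    weight is any number up to k / m; the deficit is stored in the exponent
    of f1. *)
Lemma parts_of_nfE k : parts_of_nf k @` normal_forms (k %/ m) =
  [set p | all (leq 1) p /\ power_sum m p = k.+1].
Proof.
apply/seteqP; split=> [_ [[a q] [/= q_gt0 q_wt] <-]|[|c q]] /=; [|by case|].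
  have le_q : m * power_sum m q <= k.
    by rewrite mulnC -leq_divRL // -q_wt /nf_weight leq_addl.
  by rewrite q_gt0; split; lia.
case=> /andP[c_gt0 q_gt0] p_wt.
have le_q : power_sum m q <= k %/ m by rewrite leq_divRL // mulnC; lia.
exists (k %/ m - power_sum m q, q); first by split; rewrite // /nf_weight /= subnK.
by congr cons => /=; lia.
Qed.

Lemma parts_of_nf_inj k : {in normal_forms (k %/ m) &, injective (parts_of_nf k)}.
Proof.
move=> [a p] [b q]; rewrite !inE /normal_forms /nf_weight /=.
by move=> [_ a_wt] [_ b_wt] [_ eq_pq]; move: a_wt b_wt; rewrite eq_pq => <- /addIn->.
Qed.

Lemma normal_forms0 : normal_forms 0 = [set (0, [::])].
Proof.
apply/seteqP; split=> [[[|a] [|c p]] [] //=|_ ->] //.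
by move=> /andP[c_gt0 _]; rewrite /nf_weight /=; lia.
Qed.

(** The exponent of f1 is either positive, and can be decreased, or zero, and
    then the form is a sequential partition of k + 1. *)
Lemma normal_formsS k : normal_forms k.+1 =
  incr_nf @` normal_forms k `|` pair 0 @` (parts_of_nf k @` normal_forms (k %/ m)).
Proof.
rewrite parts_of_nfE; apply/seteqP; split=> [[[|a] p] [/= p_gt0 p_wt]|x].
- by right; exists p.
- by left; exists (a, p) => //; split=> //; move: p_wt; rewrite /nf_weight /=; lia.
- by case=> [[y [y_gt0 <-] <-]|[p [p_gt0 p_wt] <-]].
Qed.

Lemma finite_normal_forms k : finite_set (normal_forms k).
Proof.
elim/ltn_ind: k => -[_|k IHk]; first by rewrite normal_forms0; exact: finite_set1.
rewrite normal_formsS finite_setU; split; first by apply: finite_image; exact: IHk.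
by do 2!apply: finite_image; apply: IHk; rewrite ltnS leq_div.
Qed.

Lemma card_normal_formsS k : #|` fset_set (normal_forms k.+1)| =
  #|` fset_set (normal_forms k)| + #|` fset_set (normal_forms (k %/ m))|.
Proof.
have fin := finite_normal_forms; rewrite normal_formsS card_fset_set_disjU.
- rewrite !card_fset_set_image //.
  + exact: parts_of_nf_inj.
  + exact: finite_image.
  + by move=> p q _ _ [].
  + by move=> [a p] [b q] _ _ [-> ->].
- exact: finite_image.
- exact/finite_image/finite_image.
- by apply/seteqP; split=> // x [[y _ <-] [p _]].
Qed.

Lemma semigroupJ (t : seq (J m)) : semigroup (J m) (act_seq t).
Proof.
elim: t => [|q t IHt] S [mul gen].
  have -> : act_seq ([::] : seq (J m)) = act (Je : J m).
    by apply/funext => w; rewrite act_Je.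
  by apply: gen; exists (Je : J m).
apply: (mul (act q) (act_seq t)); first by apply: gen; exists q.
exact: (IHt S (conj mul gen)).
Qed.

(** Shorter products are padded with the identity state e. *)
Lemma productsJ (t : seq (J m)) l : size t <= l -> products (J m) l (act_seq t).
Proof.
move=> le_t; pose u : seq (J m) := nseq (l - size t) Je ++ t.
have su : size u == l by rewrite size_cat size_nseq subnK.
exists (Tuple su) => //=; rewrite act_seq_cat act_seq_nseq.
by apply/funext => w /=; elim: (l - size t) => //= k ->; rewrite act_Je.
Qed.

Lemma productsE l : products (J m) l =
  @nf_act n @` [set x | all (leq 1) x.2 /\ nf_weight n x <= l].
Proof.
apply/seteqP; split=> [_ [t _ <-]|_ [x [x_gt0 le_x] <-]].
  case: (act_seq_reduce t) => x [x_gt0 le_x ->].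
  by exists x; rewrite // -(size_tuple t).
by apply: productsJ; rewrite size_nf_word.
Qed.

(** By reduction an element of length l has a normal form of weight at most l,
    and by uniqueness of normal forms no shorter product represents it. *)
Lemma sphereE l : sphere (J m) l = @nf_act n @` normal_forms l.
Proof.
apply/seteqP; split=> [s [_ [[-> ->]|[_ s_prod s_min]]]|_ [x [x_gt0 x_wt] <-]].
- by exists (0, [::]).
- move: s_prod s_min; rewrite productsE => -[x [x_gt0 le_x] <-] s_min.
  exists x => //; split=> //; apply/eqP; rewrite eqn_leq le_x s_min //.
  by rewrite productsE; exists x.
split; first exact: semigroupJ.
have [x0|x0] := eqVneq x (0, [::]); first by left; rewrite -x_wt x0.
right; split=> [xid||k].
- by move/eqP: x0; apply; apply: (@nf_act_inj n).
- by rewrite productsE; exists x => /=; rewrite ?x_wt.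
- rewrite productsE => -[y [y_gt0 le_y] eq_yx].
  by rewrite -x_wt -(nf_act_inj y_gt0 x_gt0 eq_yx).
Qed.

Lemma word_growthE l : word_growth (J m) l = #|` fset_set (normal_forms l)|.
Proof.
rewrite /word_growth sphereE card_fset_set_image //; first exact: finite_normal_forms.
by move=> x y; rewrite !inE => -[x_gt0 _] [y_gt0 _]; exact: nf_act_inj.
Qed.

Lemma word_growth0 : word_growth (J m) 0 = 1.
Proof. by rewrite word_growthE normal_forms0 fset_set1 cardfs1. Qed.

Lemma word_growthS l :
  word_growth (J m) l.+1 = word_growth (J m) l + word_growth (J m) (l %/ m).
Proof. by rewrite !word_growthE card_normal_formsS. Qed.

Lemma growth0 : growth (J m) 0 = 1.
Proof.
rewrite growthE (_ : products _ _ = [set id]) ?fset_set1 ?cardfs1 //.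
apply/seteqP; split=> [_ [t _ <-]|_ ->]; first by rewrite (tuple0 t).
by exists [tuple].
Qed.

Lemma productsS l : products (J m) l.+1 = products (J m) l `|` sphere (J m) l.+1.
Proof.
rewrite !productsE sphereE -image_setU; congr (_ @` _).
apply/seteqP; split=> x /=; last by case=> -[x_gt0 x_wt]; split=> //; lia.
by case=> x_gt0; rewrite leq_eqVlt ltnS => /orP[/eqP|]; [right|left].
Qed.

Lemma growthS l : growth (J m) l.+1 = growth (J m) l + word_growth (J m) l.+1.
Proof.
rewrite !growthE productsS card_fset_set_disjU //.
- exact/finite_image/finite_finset.
- exact: finite_sphere.
- apply/seteqP; split=> // s [s_prod [_ [[_ //]|[_ _ /(_ l s_prod)]]]].
  by rewrite ltnn.
Qed.

(** Over the block q m, ..., q m + m - 1 each increment of the word growth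
    equals its value at q. *)
Lemma word_growth_growth l : word_growth (J m) (m * l.+1) = (m * growth (J m) l).+1.
Proof.
have block q r : r <= m ->
    word_growth (J m) (q * m + r) = word_growth (J m) (q * m) + r * word_growth (J m) q.
  elim: r => [|r IHr] rm; first by rewrite addn0 mul0n addn0.
  by rewrite addnS word_growthS IHr 1?ltnW // divnMDl // divn_small // addn0 mulSn; lia.
have step q : word_growth (J m) (m * q.+1) =
    word_growth (J m) (m * q) + m * word_growth (J m) q.
  by rewrite mulnS addnC (mulnC _ q) block.
elim: l => [|l IHl]; first by rewrite step muln0 growth0 word_growth0.
by rewrite step IHl growthS mulnDr.
Qed.

Lemma power_sumE p : \sum_(i < size p) nth 0 p i * m ^ i = power_sum m p.
Proof.
elim: p => [|c p IHp] /=; first by rewrite big_ord0.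
rewrite big_ord_recl /= muln1 -IHp big_distrr /=; congr (_ + _).
by apply: eq_bigr => i _; rewrite expnS mulnCA.
Qed.

Lemma seq_power_partitionsE k :
  seq_power_partitions m k.+1 = [set p | all (leq 1) p /\ power_sum m p = k.+1].
Proof.
apply/seteqP; split=> p /=.
  by case=> _ p_sum p_gt0; rewrite -power_sumE; split=> //; apply/(all_nthP 0).
case=> /(all_nthP 0) p_gt0 p_sum; split=> //; last by rewrite power_sumE.
by case: p p_sum {p_gt0}.
Qed.

Lemma card_seq_power_partitions k :
  #|` fset_set (seq_power_partitions m k.+1)| = word_growth (J m) (k %/ m).
Proof.
rewrite seq_power_partitionsE -parts_of_nfE card_fset_set_image ?word_growthE //.
- exact: finite_normal_forms.
- exact: parts_of_nf_inj.
Qed.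

End Counting.

Local Open Scope ring_scope.
Import GRing.Theory Num.Theory.

Theorem corollary2p5 (m : nat) (hm : (2 <= m)%N) :
  [/\ forall n : nat,
        (word_growth (J m) n.+1)%:Z - (word_growth (J m) n)%:Z =
        (word_growth (J m) (n %/ m)%N)%:Z,
      forall n : nat,
        (growth (J m) n)%:R =
        m%:R^-1 * ((word_growth (J m) (m * n.+1)%N)%:R - 1) :> rat
    & forall n : nat, (1 <= n)%N ->
        growth_diff2 m n = #|` fset_set (seq_power_partitions m n)|%:Z].
Proof.
case: m hm => [|[|m]] // _; split=> [n|n|[//|n] _].
- by rewrite word_growthS PoszD addrC addKr.
- rewrite word_growth_growth -[X in X - 1]natr1 addrK natrM mulKf //.
  by rewrite pnatr_eq0.
rewrite card_seq_power_partitions.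
case: n => [|[|n]]; rewrite /growth_diff2.
- by rewrite word_growth0.
- by rewrite divn_small // word_growth0.
rewrite /= /fdiff /= !growthS (word_growthS _ n.+2) !PoszD; ring.
Qed.
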